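(* Let $n\geq 1$ and $k\geq 1$ be integers, let $\lambda$ be a partition with $l(\lambda)$ parts, and let $N$ be an integer with $N\geq kn+l(\lambda)$. Then \[ p_{k,N}[n]\, x^\delta\, s_{\lambda,N}[n]=\sum_\sigma(-1)^{ht(\sigma\setminus\lambda)}\,x^\delta\, s_{\sigma,N}[n], \] where the sum is over all partitions $\sigma$ obtained from $\lambda$ by adding a border strip of length $kn$, and \[ x^\delta:=(x_{-1,1}\cdots x_{-N,1})(x_{-2,2}\cdots x_{-N,2})\cdots(x_{-N,N})=\prod_{j=1}^{N}\prod_{i=j}^{N}x_{-i,j}. \]
   Context: The variables are $\{x_{i,j}: i\in\mathbb{Z}/n\mathbb{Z},\ j\in\mathbb{Z}_{\geq 1}\}$; the first index of a variable is always read modulo $n$. A partition is identified with its Young diagram (English convention: rows justified to the northwest, row $i$ having $\lambda_i$ boxes, rows and columns indexed from $1$). The box $\square$ in row $i$ and column $j$ has content $j-i$ and color $j-i \bmod n$. A semi-standard Young tableau (SSYT) of $\lambda$ is an assignment of positive integers to the boxes of $\lambda$, weakly increasing from left to right along rows and strictly increasing from top to bottom along columns; $w(\square,T)$ is the number in box $\square$ of $T$. Loop Schur function: $s_\lambda[n]:=\sum_{T} x^T$, the sum over all SSYT $T$ of $\lambda$, where $x^T:=\prod_{\square\in\lambda}x_{c,\,w(\square,T)}$ with $c\in\mathbb{Z}/n\mathbb{Z}$ the color of $\square$. Loop power-sum function: $p_k[n]:=\sum_{j\geq 1}\left(\prod_{i=0}^{n-1}x_{i,j}\right)^k$. The polynomials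 $p_{k,N}[n]$ and $s_{\lambda,N}[n]$ are obtained from $p_k[n]$ and $s_\lambda[n]$ by setting $x_{i,j}=0$ for all $j>N$. Border strip: $\sigma$ is obtained from $\lambda$ by adding a length $m$ border strip if $\sigma\supset\lambda$ are Young diagrams such that the complement $\sigma\setminus\lambda$ is connected (boxes adjacent along edges), contains exactly $m$ boxes, and contains no $2\times 2$ square. The height $ht(\sigma\setminus\lambda)$ is the number of rows occupied by $\sigma\setminus\lambda$, minus $1$. *)

(* Defs.v *)
From HB Require Import structures.
From mathcomp Require Import all_boot all_order all_algebra.
From mathcomp Require Import finmap mpoly.
From mathcomp Require Import boolp classical_sets functions cardinality fsbigop.

Set Implicit Arguments.
Unset Strict Implicit.
Unset Printing Implicit Defensive.

Import GRing.Theory.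
Local Open Scope ring_scope.

(** Partitions and Young diagrams *)

Definition is_partition (lambda : seq nat) : bool :=
  sorted geq lambda && (0%N \notin lambda).

(* Boxes are pairs (row, column), both indexed from 1. *)
Definition young (lambda : seq nat) : {fset nat * nat} :=
  [fset b in [seq (r, c) | r <- iota 1 (size lambda),
                           c <- iota 1 (nth 0%N lambda r.-1)]]%fset.

Definition color (n : nat) (b : nat * nat) : int :=
  ((b.2%:Z - b.1%:Z) %% n%:Z)%Z.

Definition is_ssyt (lambda : seq nat) (T : {ffun young lambda -> nat}) : Prop :=
  [/\ forall b, (0 < T b)%N,
      forall b b' : young lambda, (val b).1 = (val b').1 ->
        ((val b).2 <= (val b').2)%N -> (T b <= T b')%N
    & forall b b' : young lambda, (val b).2 = (val b').2 ->
        ((val b).1 < (val b').1)%N -> (T b < T b')%N].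

(** Border strips *)

Definition skew_shape (sigma lambda : seq nat) : {fset nat * nat} :=
  (young sigma `\` young lambda)%fset.

Definition adjacent (b b' : nat * nat) : bool :=
  ((b.1 == b'.1) && ((b.2 == b'.2.+1) || (b'.2 == b.2.+1))) ||
  ((b.2 == b'.2) && ((b.1 == b'.1.+1) || (b'.1 == b.1.+1))).

Definition edge_connected (D : {fset nat * nat}) : Prop :=
  forall b b' : D, connect (fun u v : D => adjacent (val u) (val v)) b b'.

Definition has_square (D : {fset nat * nat}) : Prop :=
  exists r c : nat,
    [/\ (r, c) \in D, (r, c.+1) \in D, (r.+1, c) \in D & (r.+1, c.+1) \in D].

Definition adds_border_strip (m : nat) (lambda sigma : seq nat) : Prop :=
  [/\ (young lambda `<=` young sigma)%fset,
      edge_connected (skew_shape sigma lambda),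
      #|` skew_shape sigma lambda| = m
    & ~ has_square (skew_shape sigma lambda)].

Definition height (D : {fset nat * nat}) : nat :=
  #|` [fset b.1 | b in D]%fset|.-1.

(** Loop symmetric functions *)

(* The loop functions are infinite sums, written below as functions of the
   family x of values of their variables. The operator \sum_(i \in A) is the
   sum over a possibly infinite set of indices of a family with finite support
   (it is 0 by convention when the support is infinite). Whenever x i j = 0 for
   all j > N, only the tableaux with all entries at most N and the indices
   j <= N contribute, so that both supports are finite: see
   finite_power_sum_support and finite_schur_support. *)

Definition loop_power_sum (A : comNzRingType) (n : nat)
    (x : int -> nat -> A) (k : nat) : A :=
  \sum_(j \in [set j : nat | (0 < j)%N]%classic) (\prod_(i < n) x i%:Z j) ^+ k.

Definition loop_schur (A : comNzRingType) (n : nat)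
    (x : int -> nat -> A) (lambda : seq nat) : A :=
  \sum_(T \in [set T | is_ssyt T]%classic)
    \prod_(b : young lambda) x (color n (val b)) (T b).

(** Truncation to finitely many variables *)

(* The variable x_{i,j}, with i read modulo n, after x_{i,j} has been set to 0
   for all j > N. The variables that remain, for residues i = 0 .. n-1 and
   1 <= j <= N, are numbered through mxvec_index : 'I_n -> 'I_N -> 'I_(n * N). *)
Definition xvar (R : comNzRingType) (n N : nat) (i : int) (j : nat) :
    {mpoly R[n * N]} :=
  if (0 < j)%N then
    match insub `|(i %% n%:Z)%Z|%N : option 'I_n, insub j.-1 : option 'I_N with
    | Some a, Some b => 'X_(mxvec_index a b)
    | _, _ => 0
    end
  else 0.

Definition power_sumN (R : comNzRingType) (n N k : nat) : {mpoly R[n * N]} :=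
  loop_power_sum n (@xvar R n N) k.

Definition schurN (R : comNzRingType) (n N : nat) (lambda : seq nat) :
    {mpoly R[n * N]} :=
  loop_schur n (@xvar R n N) lambda.

Definition xdelta (R : comNzRingType) (n N : nat) : {mpoly R[n * N]} :=
  \prod_(1 <= j < N.+1) \prod_(j <= i < N.+1) xvar R n N (- i%:Z) j.

(** Well-definedness *)

Lemma xvar_mod (R : comNzRingType) (n N : nat) (i i' : int) (j : nat) :
  (i = i' %[mod n%:Z])%Z -> xvar R n N i j = xvar R n N i' j.
Proof. by rewrite /xvar => ->. Qed.

Lemma xvar_trunc (R : comNzRingType) (n N : nat) (i : int) (j : nat) :
  (N < j)%N -> xvar R n N i j = 0.
Proof.
case: j => // j lt_Nj; rewrite /xvar /=.
by case: insub => // a; rewrite insubF // ltnNge -ltnS lt_Nj.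
Qed.

Lemma xvarE (R : comNzRingType) (n N : nat) (a : 'I_n) (b : 'I_N) :
  xvar R n N a%:Z b.+1 = 'X_(mxvec_index a b).
Proof. by rewrite /xvar /= modz_nat absz_nat modn_small // !valK. Qed.

Lemma finite_power_sum_support (A : comNzRingType) (n N k : nat)
    (x : int -> nat -> A) :
    (0 < n)%N -> (0 < k)%N -> (forall i j, (N < j)%N -> x i j = 0) ->
  finite_set [set j | (\prod_(i < n) x i%:Z j) ^+ k != 0]%classic.
Proof.
move=> n_gt0 k_gt0 x0; apply: (sub_finite_set _ (finite_II N.+1)) => j /=.
rewrite ltnS leqNgt; apply: contraNN => lt_Nj.
by rewrite (bigD1 (Ordinal n_gt0)) //= x0 // mul0r expr0n gtn_eqF.
Qed.

Lemma finite_schur_support (A : comNzRingType) (n N : nat) (lambda : seq nat)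
    (x : int -> nat -> A) :
    (forall i j, (N < j)%N -> x i j = 0) ->
  finite_set [set T : {ffun young lambda -> nat}
    | \prod_(b : young lambda) x (color n (val b)) (T b) != 0]%classic.
Proof.
move=> x0.
pose F (S : {ffun young lambda -> 'I_N.+1}) :=
  [ffun b => S b : nat] : {ffun young lambda -> nat}.
apply: (@sub_finite_set _ _ (F @` setT)%classic); last first.
  by apply: finite_image; exact: finite_finset.
move=> T /= T0; exists [ffun b => inord (T b)] => //.
apply/ffunP=> b; rewrite !ffunE inordK // ltnS leqNgt; apply: contraNN T0.
by move=> lt_NT; rewrite (bigD1 b) //= x0 // mul0r.
Qed.

Lemma mem_young (lambda : seq nat) (r c : nat) :
  ((r, c) \in young lambda) =
    [&& 0 < r, 0 < c & c <= nth 0%N lambda r.-1]%N.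
Proof.
rewrite inE; apply/allpairsPdep/and3P => [[r' [c' [+ + [-> ->]]]]|[r0 c0 le_c]].
  by rewrite !mem_iota !add1n !ltnS => /andP[] ? _ /andP[].
exists r, c; split=> //; rewrite mem_iota add1n ltnS ?c0 // r0 /=.
rewrite -(prednK r0) ltnNge; apply: contraL le_c => le_r.
by rewrite nth_default // -ltnNge.
Qed.

Lemma finite_add_border_strip (m : nat) (lambda : seq nat) :
  finite_set [set sigma | is_partition sigma /\
                          adds_border_strip m lambda sigma]%classic.
Proof.
pose M := (#|` young lambda| + m)%N.
pose F (u : 'I_M.+1 * {ffun 'I_M.+1 -> 'I_M.+1}) : seq nat :=
  mkseq (fun i => u.2 (inord i) : nat) u.1.
apply: (@sub_finite_set _ _ (F @` setT)%classic); last first.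
  by apply: finite_image; exact: finite_finset.
move=> sigma [/andP[_ sigma0] [sub_ls _ card_sl _]].
have card_sigma : #|` young sigma| = M.
  rewrite /M -card_sl /skew_shape cardfsD (fsetIidPr sub_ls) subnKC //.
  exact: fsubset_leq_card.
have nth_gt0 i : (i < size sigma)%N -> (0 < nth 0%N sigma i)%N.
  move=> lt_i; rewrite lt0n; apply: contra sigma0 => /eqP <-.
  exact: mem_nth.
have bound (I : seq (nat * nat)) : uniq I ->
    {subset I <= young sigma} -> (size I <= M)%N.
  by rewrite -card_sigma; exact: uniq_leq_size.
have le_size : (size sigma <= M)%N.
  rewrite -(size_iota 1 (size sigma)) -(size_map (fun r => (r, 1%N))).
  apply: bound => [|b /mapP[r + ->]].
    by rewrite map_inj_uniq ?iota_uniq // => r r' [].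
  rewrite mem_iota add1n ltnS mem_young => /andP[r_gt0 le_r].
  by rewrite r_gt0 nth_gt0 // prednK.
have le_nth i : (nth 0%N sigma i <= M)%N.
  rewrite -(size_iota 1 (nth _ _ _)) -(size_map (fun c => (i.+1, c))).
  apply: bound => [|b /mapP[c + ->]].
    by rewrite map_inj_uniq ?iota_uniq // => c c' [].
  by rewrite mem_iota add1n ltnS mem_young.
exists (inord (size sigma),
  [ffun i : 'I_M.+1 => inord (nth 0%N sigma i)]) => //.
rewrite /F /= inordK //; apply: (@eq_from_nth _ 0%N); rewrite size_mkseq //.
move=> i lt_i; rewrite nth_mkseq // ffunE inordK ?ltnS // inordK //.
exact: (ltn_trans lt_i).
Qed.

(* Main.v *)
Require Import Defs.
From mathcomp Require Import all_boot all_order all_algebra.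
From mathcomp Require Import finmap mpoly.
From mathcomp Require Import boolp classical_sets functions cardinality fsbigop.
From mathcomp Require Import fingroup perm.
From mathcomp Require Import zify ring.

(** Both sides carry the factor [xdelta], so that the theorem follows from the
    identity of its cofactors, [loop_murnaghan_nakayama].

    The classical rule follows from the bialternant formula: a power sum times an
    alternant is the sum of the alternants obtained by raising each exponent in
    turn, and sorting the exponents back yields the signs. Loop Schur functions are
    not symmetric in the second index of the variables and have no such quotient
    formula, but the argument applies to a Jacobi-Trudi determinant [flagged_det],
    whose rows are indexed by the beta numbers [lambda_i + N - i] and whose columns
    are complete homogeneous loop functions in the variables of index j, ..., N.

    - It computes the loop Schur function ([loop_schur_flagged_det]). Removing the
      entries N from a tableau leaves a tableau of an interlacing shape, and the
      determinant obeys the same branching rule ([flagged_det_branching]) because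
      row operations clear its last column.

    - The row of beta number B obeys a linear recurrence in B, with coefficients of
      period n. The shift of B by k n therefore acts on rows by a fixed matrix,
      triangular with the k-th powers of the products
      [x_{0,j} x_{1,j} ... x_{n-1,j}] on the diagonal ([flagged_h_periodic]).
      Its trace is the loop power sum, and for any matrix K the determinants
      obtained from U by applying K to one row at a time add up to
      [tr K * det U] ([sum_det_row_mul]). So the power sum times the determinant is
      the sum of the determinants with k n added to one beta number.

    - If two beta numbers collide the determinant vanishes. Otherwise sorting them
      gives the beta numbers of a partition sigma, obtained from lambda by adding a
      border strip; the row that moved from b up to t contributes the sign
      [(-1)^(b - t)], and b - t is the height of the strip. All border strips arise
      so, once each ([sum_flagged_det_strips]). *)

Set Implicit Arguments.
Unset Strict Implicit.
Unset Printing Implicit Defensive.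

Import GRing.Theory.
Local Open Scope ring_scope.

(** * Determinants *)

Section Det.
Variable (A : comNzRingType).

Lemma det_sum_rows (m M : nat) (W : 'I_m -> 'I_M -> A)
    (g : 'I_M -> 'I_m -> A) :
  \det (\matrix_(i, j) \sum_(c < M) W i c * g c j) =
  \sum_(f : {ffun 'I_m -> 'I_M})
    (\prod_i W i (f i)) * \det (\matrix_(i, j) g (f i) j).
Proof.
rewrite /determinant.
transitivity (\sum_(s : 'S_m) \sum_(f : {ffun 'I_m -> 'I_M})
   (-1) ^+ s * \prod_i (W i (f i) * g (f i) (s i))).
  apply: eq_bigr => s _; rewrite -big_distrr /=; congr (_ * _).
  under eq_bigr do rewrite mxE.
  by rewrite bigA_distr_bigA.
rewrite exchange_big /=; apply: eq_bigr => f _.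
rewrite big_distrr /=; apply: eq_bigr => s _.
under [\prod_i (\matrix_(_, _) _) _ _]eq_bigr do rewrite mxE.
by rewrite big_split /= mulrCA.
Qed.

(** By Laplace expansion along row i0, the sum is the trace of [U K adj(U)]: this
    is the derivative at 0 of the determinant of [U (1 + z K)]. *)
Lemma sum_det_row_mul (m : nat) (U K : 'M[A]_m) :
  \sum_(i0 < m) \det (\matrix_(i, j) if i == i0 then (U *m K) i j else U i j) =
  \tr K * \det U.
Proof.
transitivity (\tr ((U *m K) *m \adj U)).
  apply: eq_bigr => i0 _; rewrite (expand_det_row _ i0) mxE.
  apply: eq_bigr => j _; rewrite !mxE eqxx; congr (_ * _).
  rewrite /cofactor; congr (_ * \det _); apply/matrixP=> i j'.
  by rewrite !mxE eq_sym (negbTE (neq_lift _ _)).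
by rewrite mxtrace_mulC mulmxA mul_adj_mx mul_scalar_mx mxtraceZ mulrC.
Qed.
End Det.

(** * Flagged Jacobi-Trudi determinants *)

Section Flagged.
Variables (A : comNzRingType) (x : int -> nat -> A).

(** Columns are measured by beta numbers: with m + 1 rows, the position c of a box
    in its row exceeds its content by m. This is the weight of consecutive boxes
    that all contain m + 1. *)
Definition run_wt (m a b : nat) : A :=
  \prod_(a <= c < b) x (c%:Z - m%:Z) m.+1.

(** The complete homogeneous loop function of degree [B - (m - 1 - j)] in the
    flagged alphabet of the variables of index j + 1, ..., m, computed by splitting
    off the factors of index m. All degrees of a given j are read as one sequence
    in B. *)
Fixpoint flagged_h (m B j : nat) : A :=
  if m isn't m'.+1 then 0
  else if j == m' then run_wt m' 0 B
  else \sum_(0 <= c < B) run_wt m' c.+1 B * flagged_h m' c j.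

(** A flagged Jacobi-Trudi determinant: the substitute for the alternant of
    exponents b, which loop functions do not have for want of symmetry in their
    second index. *)
Definition flagged_det (m : nat) (b : nat -> nat) : A :=
  \det (\matrix_(i < m, j < m) flagged_h m (b i) j).

Lemma run_wt_cat m a b c : (a <= b <= c)%N ->
  run_wt m a c = run_wt m a b * run_wt m b c.
Proof. by case/andP=> ab bc; rewrite /run_wt (big_cat_nat ab bc). Qed.

Lemma run_wt_recr m a b : (a <= b)%N ->
  run_wt m a b.+1 = run_wt m a b * x (b%:Z - m%:Z) m.+1.
Proof. by move=> ab; rewrite /run_wt big_nat_recr. Qed.

Lemma run_wt_id m a : run_wt m a a = 1.
Proof. by rewrite /run_wt big_geq. Qed.

Lemma flagged_h_last m B : flagged_h m.+1 B m = run_wt m 0 B.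
Proof. by rewrite /= eqxx. Qed.

Lemma flagged_h_lt m B j : (j < m)%N -> flagged_h m.+1 B j =
  \sum_(0 <= c < B) run_wt m c.+1 B * flagged_h m c j.
Proof. by move=> jm; rewrite /= ltn_eqF. Qed.

#[local] Arguments flagged_h : simpl never.

Lemma flagged_hS m a b j : (j < m)%N -> (a <= b)%N ->
  flagged_h m.+1 b j = run_wt m a b * flagged_h m.+1 a j +
     \sum_(a <= c < b) run_wt m c.+1 b * flagged_h m c j.
Proof.
move=> jm ab; rewrite !flagged_h_lt // (big_cat_nat (leq0n a) ab) /=.
congr (_ + _); rewrite big_distrr /= !big_nat; apply: eq_bigr => c /andP[_ ca].
by rewrite mulrA [run_wt m a b * _]mulrC -run_wt_cat // ca.
Qed.

(** Subtracting from each row a multiple of the next one clears the last column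
    above its last entry, and leaves in the other columns sums over the integers
    between consecutive b i; these are expanded by multilinearity. The f are the
    beta numbers of the shapes that interlace with the one of b. *)
Lemma flagged_det_branching (m M : nat) (b : nat -> nat) :
    (forall i, (i < m)%N -> (b i.+1 < b i)%N) ->
    (forall i, (i < m)%N -> (b i <= M)%N) ->
  flagged_det m.+1 b = run_wt m 0 (b m) *
    \sum_(f : {ffun 'I_m -> 'I_M} | [forall i : 'I_m, b i.+1 <= f i < b i]%N)
      (\prod_(i < m) run_wt m (f i).+1 (b i)) *
      \det (\matrix_(i, j) flagged_h m (f i) j).
Proof.
move=> bdec bM; set S := \sum_(f | _) _.
pose U := (\matrix_(i, j) (flagged_h m.+1 (b i) j)) : 'M[A]_m.+1.
(* Left multiplication by L subtracts from each row the multiple of the next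
   row that kills its last entry. *)
pose L := (\matrix_(i, j) ((i == j)%:R -
   (j == i.+1 :> nat)%:R * run_wt m (b i.+1) (b i))) : 'M[A]_m.+1.
have detL : \det L = 1.
  rewrite -det_tr det_trig.
    rewrite big1 // => i _; rewrite !mxE eqxx.
    by rewrite (_ : (i == _ :> nat) = false) ?mul0r ?subr0 //; lia.
  apply/is_trig_mxP => i j ij; rewrite !mxE.
  rewrite (_ : (j == i) = false); last by apply/eqP => /(congr1 val) /=; lia.
  by rewrite (_ : (i == j.+1 :> nat) = false) ?mul0r ?subr0 //; lia.
have LUE (i j : 'I_m.+1) : (L *m U) i j =
    flagged_h m.+1 (b i) j - (i < m)%:R * run_wt m (b i.+1) (b i) *
    flagged_h m.+1 (b i.+1) j.
  rewrite mxE; under eq_bigr do rewrite !mxE mulrBl.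
  rewrite sumrB (bigD1 i) //= eqxx mul1r big1 ?addr0; last first.
    by move=> k; rewrite eq_sym => /negbTE ->; rewrite mul0r.
  congr (_ - _); have [im|mi] := ltnP i m.
    have iS : (i.+1 < m.+1)%N by [].
    rewrite (bigD1 (Ordinal iS)) //= eqxx big1 ?addr0 ?mul1r //.
    move=> k; rewrite -val_eqE /= => /negbTE ->.
    by rewrite !mul0r.
  rewrite mul0r mul0r big1 // => k _.
  rewrite (_ : (k == _ :> nat) = false) ?mul0r //.
  by have := ltn_ord k; lia.
have -> : flagged_det m.+1 b = \det (L *m U) by rewrite det_mulmx detL mul1r.
(* In the last column of L *m U only the last row survives. *)
rewrite (expand_det_col _ ord_max) (bigD1 ord_max) //= big1 ?addr0; last first.
  move=> i ni; rewrite LUE flagged_h_last.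
  have im : (i < m)%N.
    by have := ltn_ord i; move: ni; rewrite -val_eqE /=; lia.
  rewrite im mul1r flagged_h_last mulrC (mulrC (run_wt _ _ _)).
  by rewrite -run_wt_cat ?subrr ?mulr0 //= ltnW // bdec.
rewrite LUE /= ltnn !mul0r subr0 flagged_h_last; congr (_ * _).
rewrite /cofactor /= -signr_odd addnn odd_double expr0 mul1r.
pose W (i : 'I_m) (c : 'I_M) : A :=
  (b i.+1 <= c < b i)%N%:R * run_wt m c.+1 (b i).
have -> : row' ord_max (col' ord_max (L *m U)) =
    \matrix_(i < m, j < m) \sum_(c < M) W i c * flagged_h m c j; last first.
  rewrite det_sum_rows /S [RHS]big_mkcond /=; apply: eq_bigr => f _.
  case: ifP => [/forallP fb|/negbT].
    congr (_ * _); apply: eq_bigr => i _.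
    by rewrite /W fb mul1r.
  rewrite negb_forall => /existsP[i /negbTE fb].
  by rewrite (bigD1 i) //= /W fb !mul0r.
apply/matrixP=> i j; have im := ltn_ord i.
have liftE (k : 'I_m) : lift ord_max k = k :> nat.
  by rewrite /= /bump leqNgt ltn_ord.
rewrite mxE mxE LUE mxE !liftE im mul1r.
rewrite (flagged_hS (ltn_ord j) (ltnW (bdec i im))) addrC addKr.
have -> : \sum_(b i.+1 <= c < b i) run_wt m c.+1 (b i) * flagged_h m c j =
  \sum_(0 <= c < b i) (b i.+1 <= c)%N%:R * (run_wt m c.+1 (b i) * flagged_h m c j).
  rewrite [RHS](big_cat_nat (leq0n (b i.+1)) (ltnW (bdec i im))) /=.
  rewrite [X in _ = X + _]big_nat [X in _ = X + _]big1 ?add0r; last first.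
    by move=> c /andP[_ cb]; rewrite leqNgt cb mul0r.
  by rewrite !big_nat; apply: eq_bigr => c /andP[-> _]; rewrite mul1r.
rewrite big_mkord (big_ord_widen M (fun c => (b i.+1 <= c)%N%:R *
  (run_wt m c.+1 (b i) * flagged_h m c j)) (bM i im)) big_mkcond /=.
apply: eq_bigr => c _; rewrite /W; case: ltnP => _; last by rewrite andbF !mul0r.
by rewrite andbT mulrA.
Qed.

(** The vectors [flagged_h m B] obey a linear recurrence in B whose coefficients
    have period s, so that the shift of B by s is a linear map K. It respects the
    filtration by the index of the variables and is thus triangular, hence its
    trace. *)
Lemma flagged_h_periodic (s m : nat) :
    (forall i j, x (i + s%:Z) j = x i j) ->
  exists K : nat -> nat -> A,
    (forall B j, (j < m)%N ->
      flagged_h m (B + s) j = \sum_(i < m) flagged_h m B i * K i j) /\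
    \sum_(j < m) K j j = \sum_(j < m) \prod_(0 <= c < s) x (c%:Z - j%:Z) j.+1.
Proof.
move=> xs; elim: m => [|m [K [KE trK]]].
  by exists (fun _ _ => 0); split=> //; rewrite !big_ord0.
(* The last coordinate is an eigenvector, with eigenvalue the product of the
   variables of index m + 1 over one period; the others are shifted by the
   matrix K of the previous level plus a multiple of the last coordinate. *)
exists (fun i j => if j == m then (i == m)%:R * run_wt m 0 s
  else if i == m then flagged_h m.+1 s j else K i j); split; last first.
  rewrite !big_ord_recr /= !eqxx mul1r -trK; congr (_ + _).
  by apply: eq_bigr => j _; rewrite ltn_eqF.
have run_shift B : run_wt m 0 (B + s) = run_wt m 0 B * run_wt m 0 s.
  elim: B => [|B IH]; first by rewrite run_wt_id mul1r.
  rewrite addSn !run_wt_recr // IH (_ : x _ _ = x (B%:Z - m%:Z) m.+1); first by ring.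
  by rewrite -[RHS]xs; congr x; lia.
move=> B j; rewrite ltnS leq_eqVlt => /orP[/eqP -> | jm].
  rewrite !flagged_h_last big_ord_recr /= !eqxx flagged_h_last mul1r run_shift.
  rewrite big1 ?add0r //.
  by move=> i _; rewrite ltn_eqF // mul0r mulr0.
rewrite big_ord_recr /= ltn_eqF // eqxx !flagged_h_last !flagged_h_lt //.
under eq_bigr => i _ do rewrite flagged_h_lt // (ltn_eqF (ltn_ord i)).
elim: B => [|B IH].
  rewrite add0n run_wt_id mul1r [X in _ = X + _]big1 ?add0r // => i _.
  by rewrite big_geq // mul0r.
have rec C i : \sum_(0 <= c < C.+1) run_wt m c.+1 C.+1 * flagged_h m c i =
   x (C%:Z - m%:Z) m.+1 * (\sum_(0 <= c < C) run_wt m c.+1 C * flagged_h m c i)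
   + flagged_h m C i.
  rewrite big_nat_recr //= run_wt_id mul1r; congr (_ + _).
  rewrite big_distrr /= !big_nat; apply: eq_bigr => c /andP[_ cC].
  by rewrite run_wt_recr //; ring.
rewrite addSn rec IH KE // run_wt_recr //.
rewrite (_ : x _ _ = x (B%:Z - m%:Z) m.+1); last first.
  by rewrite -[RHS]xs; congr x; lia.
under [in RHS]eq_bigr => i _ do rewrite rec mulrDl -mulrA.
by rewrite big_split /= -big_distrr /=; ring.
Qed.

(** The analogue of multiplying an alternant by a power sum, which adds s to each
    exponent in turn. *)
Lemma flagged_det_power_sum (s m : nat) (b : nat -> nat) :
    (forall i j, x (i + s%:Z) j = x i j) ->
  \sum_(i < m) flagged_det m (fun r => if r == i :> nat then b r + s else b r)%N =
  (\sum_(j < m) \prod_(0 <= c < s) x (c%:Z - j%:Z) j.+1) * flagged_det m b.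
Proof.
move=> xs; have [K [KE <-]] := flagged_h_periodic m xs.
have := sum_det_row_mul (\matrix_(i < m, j < m) flagged_h m (b i) j)
                        (\matrix_(i < m, j < m) K i j).
rewrite /mxtrace; under [X in _ = X * _ -> _]eq_bigr do rewrite mxE.
move=> <-; apply: eq_bigr => i0 _; congr (\det _); apply/matrixP=> i j.
rewrite !mxE val_eqE; case: ifP => // _.
by rewrite KE //; apply: eq_bigr => k _; rewrite !mxE.
Qed.

End Flagged.

(** * Partitions *)

Lemma shape_antitone (l : nat -> nat) : (forall i, (l i.+1 <= l i)%N) ->
  forall i j, (i <= j)%N -> (l j <= l i)%N.
Proof.
move=> dec i j; elim: j => [|j IH]; first by rewrite leqn0 => /eqP ->.
rewrite leq_eqVlt => /orP[/eqP -> //|]; rewrite ltnS => /IH.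
exact: leq_trans.
Qed.

Lemma nth_antitone lam : is_partition lam ->
  forall i, (nth 0%N lam i.+1 <= nth 0%N lam i)%N.
Proof.
move=> /andP[sorted_lam _] i.
have [iS|iS] := ltnP i.+1 (size lam); last by rewrite nth_default.
by have /(sortedP 0%N)/(_ i iS) := sorted_lam.
Qed.

Lemma partition_ext lam sig : is_partition lam -> is_partition sig ->
  (forall r, nth 0%N lam r = nth 0%N sig r) -> lam = sig.
Proof.
have size_le lam' sig' : is_partition sig' ->
    (forall r, nth 0%N lam' r = nth 0%N sig' r) -> (size sig' <= size lam')%N.
  move=> /andP[_ sig0] e; rewrite leqNgt; apply: contra sig0 => lt_s.
  by rewrite -(nth_default 0%N (leqnn (size lam'))) e mem_nth.
move=> lp sp e; apply: (@eq_from_nth _ 0%N) => // .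
by apply/eqP; rewrite eqn_leq !size_le.
Qed.

Lemma partition_of_fun (g : nat -> nat) M :
    (forall i, g i.+1 <= g i)%N -> g M = 0%N ->
  exists sig, [/\ is_partition sig, (size sig <= M)%N
                 & forall r, nth 0%N sig r = g r].
Proof.
move=> gdec gM; have exz : exists m, g m == 0%N by exists M; apply/eqP.
case: (ex_minnP exz) => m /eqP gm mmin; exists (mkseq g m).
have nthE r : nth 0%N (mkseq g m) r = g r.
  have [rm|mr] := ltnP r m; first by rewrite nth_mkseq.
  rewrite nth_default ?size_mkseq //; have := shape_antitone gdec mr.
  by rewrite gm leqn0 => /eqP ->.
split=> //; last by rewrite size_mkseq mmin //; apply/eqP.
apply/andP; split.
  by apply/(sortedP 0%N) => i _; rewrite !nthE; apply: gdec.
apply/(nthP 0%N) => -[i]; rewrite size_mkseq nthE => im gi.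
by have := mmin i; rewrite gi leqNgt im => /(_ isT).
Qed.

(** * Branching of tableaux *)

Section Tableaux.
Variables (A : comNzRingType) (x : int -> nat -> A) (P Q N : nat).
Notation filling := {ffun 'I_P * 'I_Q -> 'I_N.+1}.
Implicit Types (T : filling) (l g : nat -> nat).

(** The shape is a function l giving the row lengths, rows and columns counted
    from 0. A tableau is extended by 0 outside of its shape to a fixed rectangle,
    so that the tableaux of all shapes inhabit one finite type. *)
Record is_tableau (m : nat) l T : Prop := IsTableau {
  tab_entry : forall b : 'I_P * 'I_Q, if (b.2 < l b.1)%N then (0 < T b <= m)%N
                        else T b == 0%N :> nat;
  tab_row : forall (r : 'I_P) (c c' : 'I_Q), (c <= c')%N -> (c' < l r)%N ->
    (T (r, c) <= T (r, c'))%N;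
  tab_col : forall (r r' : 'I_P) (c : 'I_Q), (r < r')%N -> (c < l r')%N ->
    (T (r, c) < T (r', c))%N }.

Definition filling_wt l T : A :=
  \prod_(b : 'I_P * 'I_Q | (b.2 < l b.1)%N) x (b.2%:Z - b.1%:Z) (T b).

Definition tableau_sum (m : nat) l : A :=
  \sum_(T : filling | `[< is_tableau m l T >]) filling_wt l T.

(** The shape of the entries at most m, whose row r ends with its last such
    entry. *)
Definition subshape m T (r : nat) : nat :=
  \max_(b : 'I_P * 'I_Q | (b.1 == r :> nat) && (0 < T b <= m)%N) b.2.+1.

(** [restrict] removes the entries m + 1 from a tableau, and [extend] fills with
    m + 1 the boxes of l outside of the shape g: these are the two directions of the
    branching bijection. *)
Definition restrict m T : filling :=
  [ffun b : 'I_P * 'I_Q => if (T b <= m)%N then T b else ord0].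

Definition extend m l g T : filling :=
  [ffun b : 'I_P * 'I_Q => if (b.2 < g b.1)%N then T b
             else if (b.2 < l b.1)%N then inord m.+1 else ord0].

Lemma subshapeP m T (g : nat -> nat) :
    (forall r, (g r <= Q)%N) -> (forall r, (P <= r)%N -> g r = 0%N) ->
    (forall b : 'I_P * 'I_Q, (0 < T b <= m)%N = (b.2 < g b.1)%N) ->
  subshape m T = g.
Proof.
move=> gQ gP Tg; apply/funext => r; apply/eqP; rewrite eqn_leq; apply/andP; split.
  by apply/bigmax_leqP => b /andP[/eqP <-]; rewrite Tg.
have [gr0|] := posnP (g r); first by rewrite gr0.
case: (ltnP r P) => [rP|/gP ->//] gr.
have cQ : ((g r).-1 < Q)%N by rewrite prednK.
apply: (@bigmax_sup _ (Ordinal rP, Ordinal cQ)); last by rewrite /= prednK.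
by rewrite eqxx Tg /= prednK /=.
Qed.

Record fits m l : Prop := Fits {
  fits_row : (m <= P)%N;
  fits_entry : (m <= N)%N;
  fits_antitone : forall i, (l i.+1 <= l i)%N;
  fits_zero : forall i, (m <= i)%N -> l i = 0%N;
  fits_col0 : (l 0 <= Q)%N }.

Lemma fits_col m l r : fits m l -> (l r <= Q)%N.
Proof.
case=> _ _ ldec _; apply: leq_trans.
exact: shape_antitone ldec _ _ (leq0n r).
Qed.

Section Step.
Variables (m : nat) (l : nat -> nat).
Hypothesis ml : fits m.+1 l.

Let mP : (m < P)%N. Proof. exact: fits_row ml. Qed.
Let mN : (m < N)%N. Proof. exact: fits_entry ml. Qed.
Let ldec i : (l i.+1 <= l i)%N. Proof. exact: fits_antitone ml i. Qed.
Let l0 i : (m < i)%N -> l i = 0%N. Proof. exact: (fits_zero ml). Qed.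
Let lleQ r : (l r <= Q)%N. Proof. exact: fits_col ml. Qed.

Lemma subshape_entry T : is_tableau m.+1 l T ->
  forall b : 'I_P * 'I_Q, (0 < T b <= m)%N = (b.2 < subshape m T b.1)%N.
Proof.
move=> tT [r c] /=; apply/idP/idP => [Trc|].
  by apply: (@bigmax_sup _ (r, c)) => //=; rewrite eqxx.
apply: contraTT => nT; rewrite -leqNgt.
apply/bigmax_leqP => -[r' c'] /= /andP[/eqP/val_inj -> T']; rewrite ltnNge.
apply: contra nT => cc'; have := tab_entry tT (r, c'); have := tab_entry tT (r, c).
rewrite /=; case: (ltnP c (l r)) => [cl|]; case: (ltnP c' (l r)) => [cl'|]; try lia.
by have := tab_row tT cc' cl'; lia.
Qed.

(** A box of row r + 1 has a smaller entry above it, which is thus at most m. *)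
Lemma subshape_interlace T : is_tableau m.+1 l T ->
  forall r, (l r.+1 <= subshape m T r <= l r)%N.
Proof.
move=> tT r; apply/andP; split; last first.
  apply/bigmax_leqP => b /andP[/eqP <- Tb]; have := tab_entry tT b.
  by case: ltnP => //; lia.
have [->//|lr] := posnP (l r.+1).
have rP : (r.+1 < P)%N.
  by rewrite ltnNge; apply: contraTN lr => ?; rewrite l0 //; lia.
have cQ : ((l r.+1).-1 < Q)%N by have := lleQ r.+1; lia.
pose r0 := Ordinal (ltnW rP); pose r1 := Ordinal rP; pose c := Ordinal cQ.
have := subshape_entry tT (r0, c); rewrite /= prednK // => <-.
have cl : (c < l r1)%N by rewrite /= prednK.
have := tab_entry tT (r1, c); rewrite cl.
have := tab_col tT (ltnSn r : (r0 < r1)%N) cl.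
have := tab_entry tT (r0, c); rewrite /= ifT; first by lia.
by have := ldec r; move: lr; case: (l r.+1) => //=; lia.
Qed.

(** Columns are strict, so that the entries of row r exceed r; hence the entries
    at most m lie in the first m rows. *)
Lemma tableau_entry_gt_row T : is_tableau m.+1 l T ->
  forall (r : 'I_P) (c : 'I_Q), (c < l r)%N -> (r < T (r, c))%N.
Proof.
move=> tT [r rP] c; elim: r rP => [|r IH] rP /= cl.
  by have := tab_entry tT (Ordinal rP, c); rewrite /= cl => /andP[].
have cl' : (c < l r)%N by apply: leq_trans cl (ldec r).
apply: leq_ltn_trans (IH (ltnW rP) cl') _.
exact: (tab_col tT (r := Ordinal (ltnW rP)) (r' := Ordinal rP)).
Qed.

Lemma subshape_rows T : is_tableau m.+1 l T ->
  forall r, (m <= r)%N -> subshape m T r = 0%N.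
Proof.
move=> tT r mr; apply/eqP; rewrite -leqn0.
apply/bigmax_leqP => -[r' c] /andP[/= /eqP rr' Tb].
have := tab_entry tT (r', c) => /=; case: ltnP => [cl|]; last by lia.
by have := tableau_entry_gt_row tT cl; lia.
Qed.

Lemma restrict_tableau T : is_tableau m.+1 l T ->
  is_tableau m (subshape m T) (restrict m T).
Proof.
move=> tT; split.
- move=> b; rewrite -subshape_entry // ffunE; case: ifP => [/andP[? mT]|].
    by rewrite mT; lia.
  by case: (leqP (T b) m) => //; case: (nat_of_ord (T b)).
- move=> r c c' cc' c'l; have := subshape_entry tT (r, c').
  have := subshape_entry tT (r, c); rewrite /= c'l (leq_ltn_trans cc') // !ffunE.
  move=> /andP[? ->] /andP[? ->]; apply: (tab_row tT) => //.
  by apply: leq_trans c'l _; case/andP: (subshape_interlace tT r).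
- move=> r r' c rr' cl; have := subshape_entry tT (r', c).
  rewrite cl !ffunE => /andP[? /= T'm].
  have := tab_col tT rr' (leq_trans cl (proj2 (andP (subshape_interlace tT r')))).
  by rewrite T'm => /[dup] TT' /ltnW/leq_trans -> //.
Qed.

Lemma restrictK T : is_tableau m.+1 l T ->
  extend m l (subshape m T) (restrict m T) = T.
Proof.
move=> tT; apply/ffunP => b; rewrite !ffunE -subshape_entry //.
case: (boolP (0 < T b <= m)%N) => [/andP[_ ->] //|nT].
have := tab_entry tT b; case: ifP => _ Tb; apply/val_inj => /=.
  by rewrite inordK //; lia.
by rewrite (eqP Tb).
Qed.

Section Extend.
Variables (g : nat -> nat) (T : filling).
Hypotheses (gl : forall r, (l r.+1 <= g r <= l r)%N) (tT : is_tableau m g T).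

Lemma extend_tableau : is_tableau m.+1 l (extend m l g T).
Proof.
have gE r : (g r <= l r)%N by case/andP: (gl r).
have bound (r : 'I_P) (c : 'I_Q) : (c < g r)%N -> (0 < T (r, c) <= m)%N.
  by move=> cg; have := tab_entry tT (r, c); rewrite cg.
split.
- move=> b; rewrite ffunE; have := tab_entry tT b; have := gE b.1.
  case: (ltnP b.2 (g b.1)) => [bg gle|_ gle _]; last first.
    by case: (ltnP b.2 (l b.1)); rewrite ?inordK //; lia.
  by rewrite (leq_trans bg gle); lia.
- move=> r c c' cc' c'l; rewrite !ffunE /= c'l (leq_ltn_trans cc' c'l).
  case: (ltnP c') => [c'g|gc'].
    by rewrite (leq_ltn_trans cc' c'g); apply: (tab_row tT).
  case: (ltnP c (g r)) => [cg|//]; rewrite inordK //.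
  by have := bound _ _ cg; lia.
- move=> r r' c rr' cl; rewrite !ffunE /= cl.
  have cg : (c < g r)%N.
    apply: leq_trans cl _; apply: leq_trans (shape_antitone ldec rr') _.
    by case/andP: (gl r).
  rewrite cg; case: (ltnP c (g r')) => [cg'|_]; first exact: (tab_col tT).
  by rewrite inordK //; have := bound _ _ cg; lia.
Qed.

Lemma subshape_extend : subshape m (extend m l g T) = g.
Proof.
have gE r : (g r <= l r)%N by case/andP: (gl r).
apply: subshapeP => [r|r Pr|b].
- exact: leq_trans (gE r) (lleQ r).
- by apply/eqP; rewrite -leqn0 -(l0 (leq_trans mP Pr)).
have := tab_entry tT b; rewrite ffunE; case: (ltnP b.2 (g b.1)) => // _ _.
by case: (ltnP b.2 (l b.1)) => _ //; rewrite inordK //; lia.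
Qed.

Lemma extendK : restrict m (extend m l g T) = T.
Proof.
apply/ffunP => b; rewrite !ffunE; have := tab_entry tT b.
case: (ltnP b.2 (g b.1)) => [_ /andP[_ ->] //|_ /eqP Tb].
case: (ltnP b.2 (l b.1)) => [_|_]; first by rewrite inordK // ltnn; apply/val_inj.
by apply/val_inj; rewrite /= Tb.
Qed.

Lemma filling_wt_extend : filling_wt l (extend m l g T) =
  filling_wt g T *
  \prod_(r < m.+1) \prod_(g r <= c < l r) x (c%:Z - r%:Z) m.+1.
Proof.
have gE r : (g r <= l r)%N by case/andP: (gl r).
rewrite /filling_wt (bigID (fun b : 'I_P * 'I_Q => (b.2 < g b.1)%N)) /=; congr (_ * _).
  apply: eq_big => [b|b /andP[_ bg]]; last by rewrite ffunE bg.
  by case: (ltnP b.2 (g b.1)) => [bg|_]; rewrite ?andbF // (leq_trans bg).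
transitivity (\prod_(r < P) \prod_(c < Q | (g r <= c < l r)%N)
    x (c%:Z - r%:Z) m.+1).
  rewrite pair_big_dep /=; apply: eq_big => [b|b /andP[bl bg]].
    by rewrite andbC -leqNgt.
  by rewrite ffunE (negbTE bg) bl inordK.
transitivity (\prod_(r < P) \prod_(g r <= c < l r) x (c%:Z - r%:Z) m.+1).
  apply: eq_bigr => r _; rewrite (big_nat_widen _ _ Q) ?lleQ //.
  rewrite (big_nat_widenl _ 0) // big_mkord.
  by apply: eq_bigl => c; rewrite /= andbC.
rewrite (big_ord_widen P (fun r => \prod_(g r <= c < l r) x (c%:Z - r%:Z) m.+1) mP).
rewrite [LHS](bigID (fun r : 'I_P => r < m.+1)%N) /= [X in _ * X]big1 ?mulr1 //.
move=> r mr; rewrite big_geq // l0 //; lia.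
Qed.

End Extend.
End Step.

(** Both sides obey the same branching rule: removing the entries m + 1 of a
    tableau leaves a tableau of an interlacing shape. *)
Lemma tableau_sum_flagged_det m l : fits m l ->
  tableau_sum m l = flagged_det x m (fun i => l i + (m - i.+1))%N.
Proof.
elim: m l => [|m IH] l ml; have [mP mN ldec l0 lQ] := ml.
  rewrite /flagged_det det_mx00 /tableau_sum.
  rewrite (big_pred1 [ffun=> ord0]).
    by rewrite /filling_wt big_pred0 // => b; rewrite l0.
  move=> T /=; apply/asboolP/eqP => [tT|->].
    apply/ffunP=> b; rewrite ffunE; apply/val_inj/eqP.
    by have := tab_entry tT b; rewrite l0.
  by split => [b|r c c' _|r r' c _]; rewrite ?l0 // ffunE.
pose b i := (l i + (m - i))%N.
rewrite [RHS](_ : _ = flagged_det x m.+1 b) //.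
pose M := (Q + m).+1.
have lleQ r : (l r <= Q)%N by apply: fits_col ml.
rewrite (@flagged_det_branching _ _ m M); first last.
- by move=> i im; rewrite /b /M; have := lleQ i; lia.
- by move=> i im; rewrite /b; have := ldec i; lia.
(* The tableaux are grouped by the beta numbers of their entries at most m. *)
pose p T : {ffun 'I_m -> 'I_M} :=
  [ffun i : 'I_m => inord (subshape m T i + (m - i.+1))].
have pE T (i : 'I_m) : is_tableau m.+1 l T ->
    p T i = (subshape m T i + (m - i.+1))%N :> nat.
  move=> tT; rewrite ffunE inordK // /M ltnS.
  have /andP[_ h] := subshape_interlace ml tT i.
  by have := lleQ i; lia.
rewrite /tableau_sum.
rewrite (partition_big p (fun f => [forall i : 'I_m, b i.+1 <= f i < b i])%N);
    last first.
  move=> T /asboolP tT; apply/forallP => i; rewrite pE //.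
  have := subshape_interlace ml tT i; have := ltn_ord i.
  by rewrite /b; lia.
rewrite big_distrr /=; apply: eq_bigr => f /forallP fb.
pose g r := oapp (fun i : 'I_m => f i - (m - i.+1))%N 0%N (insub r).
have g_lt (i : 'I_m) : (g i + (m - i.+1) = f i)%N.
  by rewrite /g valK /=; have := fb i; rewrite /b; lia.
have g_ge r : (m <= r)%N -> g r = 0%N.
  by move=> mr; rewrite /g insubF // ltnNge mr.
have gl r : (l r.+1 <= g r <= l r)%N.
  have [rm|mr] := ltnP r m; last by rewrite g_ge // l0.
  by have := fb (Ordinal rm); have := g_lt (Ordinal rm); rewrite /b /=; lia.
have pg T : is_tableau m.+1 l T -> (p T == f) = `[< subshape m T = g >].
  move=> tT; apply/eqP/asboolP => [pf|sg].
    apply/funext => r; have [rm|mr] := ltnP r m.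
      by have := g_lt (Ordinal rm); rewrite -pf pE //=; lia.
    by rewrite g_ge // (subshape_rows ml tT mr).
  by apply/ffunP=> i; apply/val_inj; rewrite /= pE // sg g_lt.
rewrite (reindex_onto (extend m l g) (restrict m)); last first.
  by move=> T /andP[/asboolP tT]; rewrite pg // => /asboolP <-; apply: (restrictK ml).
have -> : \det (\matrix_(i < m, j < m) flagged_h x m (f i) j) = tableau_sum m g.
  rewrite IH; last first.
    split; [exact: ltnW | exact: ltnW | | exact: g_ge | ].
      by move=> i; have := gl i; have := gl i.+1; lia.
    by have := gl 0%N; lia.
  by congr (\det _); apply/matrixP => i j; rewrite !mxE g_lt.
rewrite mulrA big_distrr /=; apply: eq_big => [T|T].
  apply/andP/asboolP => [[/andP[/asboolP tT]]|tT].
    rewrite pg // => /asboolP sg /eqP <-.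
    by have := restrict_tableau ml tT; rewrite sg.
  rewrite (extendK ml tT) eqxx; split=> //.
  have tE := extend_tableau ml gl tT.
  rewrite asboolT //= pg //; apply/asboolP.
  exact: (subshape_extend ml gl tT).
case/andP=> /andP[/asboolP tE]; rewrite pg // => /asboolP sg /eqP eT.
have tT : is_tableau m g T.
  by have := restrict_tableau ml tE; rewrite sg eT.
rewrite (filling_wt_extend ml T gl) mulrC; congr (_ * _).
rewrite big_ord_recr /= mulrC; congr (_ * _).
  rewrite g_ge // /b subnn addn0 /run_wt; apply: eq_big_nat => c _.
  by congr x; lia.
apply: eq_bigr => i _; rewrite /run_wt -g_lt /b.
have im := ltn_ord i.
rewrite (_ : (_ + (m - i.+1)).+1 = (g i + (m - i)))%N; last by lia.
rewrite big_addn addnK; apply: eq_bigr => c _.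
by congr x; lia.
Qed.

End Tableaux.

(** * Loop Schur functions as determinants *)

(** Computes a sum over a possibly infinite set once its nonzero terms are
    parametrized by a finite type. *)
Lemma fsum_reindex (A : nmodType) (I : finType) (J : choiceType) (P : pred I)
    (Q : set J) (h : I -> J) (F : J -> A) :
    {in P &, injective h} -> (forall i, P i -> Q (h i)) ->
    (forall j, Q j -> F j != 0 -> exists2 i, P i & h i = j) ->
  \sum_(j \in Q) F j = \sum_(i | P i) F (h i).
Proof.
move=> hinj PQ Qh; rewrite (@fsbigE _ _ _ _ _ [seq h i | i in P]).
- rewrite big_map big_enum_cond /=; apply: eq_bigl => i.
  rewrite [i \in P]unfold_in; case: (boolP (P i)) => //= Pi.
  by rewrite mem_set //; apply: PQ.
- rewrite map_inj_in_uniq ?enum_uniq // => i i'; rewrite !mem_enum.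
  exact: hinj.
- by move=> _ /= /mapP[i + ->]; rewrite mem_enum => /PQ.
- move=> j Qj; apply: contraNeq => /(Qh j Qj)[i Pi <-].
  by apply: map_f; rewrite mem_enum.
Qed.

Section LoopSchur.
Variables (A : comNzRingType) (x : int -> nat -> A) (n N : nat).
Hypothesis x_mod : forall i i' j, (i = i' %[mod n%:Z])%Z -> x i j = x i' j.
Hypothesis x_trunc : forall i j, (N < j)%N -> x i j = 0.
Variable lam : seq nat.
Hypotheses (lam_part : is_partition lam) (lam_size : (size lam <= N)%N).

Local Notation l := (nth 0%N lam).
Local Notation Q := (nth 0%N lam 0).
Local Notation filling := {ffun 'I_N * 'I_Q -> 'I_N.+1}.

Lemma part_fits : fits N Q N N l.
Proof.
split=> // [|i Ni]; first exact: nth_antitone.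
by rewrite nth_default // (leq_trans lam_size).
Qed.

Lemma young_row (b : young lam) : ((val b).1.-1 < N)%N.
Proof.
case: b => [[r c] /=]; rewrite mem_young => /and3P[r0 c0 cl].
rewrite ltnNge; apply: contraTN cl => Nr.
by rewrite nth_default ?(leq_trans lam_size) // -ltnNge.
Qed.

Lemma young_col (b : young lam) : ((val b).2.-1 < Q)%N.
Proof.
case: b => [[r c] /=]; rewrite mem_young => /and3P[r0 c0 cl].
by rewrite prednK //; apply: leq_trans cl (fits_col _ part_fits).
Qed.

Definition box_of (b : young lam) : 'I_N * 'I_Q :=
  (Ordinal (young_row b), Ordinal (young_col b)).

Lemma box_of_val (r : 'I_N) (c : 'I_Q) (b : young lam) :
  (r, c) = box_of b -> (val b).1 = r.+1 /\ (val b).2 = c.+1.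
Proof.
case=> /(congr1 val) /= -> /(congr1 val) /= ->; have := fsvalP b.
by case: (fsval b) => ? ?; rewrite mem_young /= => /and3P[? ? _]; rewrite !prednK.
Qed.

Lemma box_of_inj : injective box_of.
Proof.
move=> b b' bb'; have [r c] := box_of_val (erefl (box_of b)).
have [r' c'] := box_of_val bb'.
by apply/val_inj/eqP; rewrite -pair_eqE /pair_eq r c r' c' !eqxx.
Qed.

Lemma box_of_shape (b : young lam) : ((box_of b).2 < l (box_of b).1)%N.
Proof.
have := fsvalP b; rewrite /box_of /=; case: (fsval b) => r c.
by rewrite mem_young /=; lia.
Qed.

Lemma box_of_surj (b : 'I_N * 'I_Q) :
  (b.2 < l b.1)%N -> exists b', b = box_of b'.
Proof.
case: b => r c cl; have rc : (r.+1, c.+1) \in young lam by rewrite mem_young.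
by exists [` rc]%fset; congr (_, _); apply/val_inj.
Qed.

Definition ffun_of_filling (T : filling) : {ffun young lam -> nat} :=
  [ffun b => T (box_of b) : nat].

Lemma tableau_ssyt (T : filling) : is_tableau N l T -> is_ssyt (ffun_of_filling T).
Proof.
move=> tT; split=> [b|b b' rr' cc'|b b' cc' rr']; rewrite !ffunE.
- by have := tab_entry tT (box_of b); rewrite box_of_shape => /andP[].
- have -> : box_of b = ((box_of b').1, (box_of b).2).
    by congr (_, _); apply/val_inj; rewrite /= rr'.
  rewrite [X in (_ <= T X)%N]surjective_pairing; apply: (tab_row tT).
    by rewrite /= -!subn1 leq_sub2r.
  exact: box_of_shape.
- have -> : box_of b = ((box_of b).1, (box_of b').2).
    by congr (_, _); apply/val_inj; rewrite /= cc'.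
  rewrite [X in (_ < T X)%N]surjective_pairing; apply: (tab_col tT).
    have := fsvalP b; move: rr'; rewrite /=; case: (fsval b) => ? ?.
    by rewrite mem_young /=; lia.
  exact: box_of_shape.
Qed.

(** The flagged Jacobi-Trudi formula, in N variables for a shape with at most N
    rows. It remains to see the semi-standard tableaux with entries at most N as
    fillings of the rectangle; the other ones contribute 0. *)
Lemma loop_schur_flagged_det :
  loop_schur n x lam = flagged_det x N (fun i => l i + (N - i.+1))%N.
Proof.
rewrite -(tableau_sum_flagged_det x part_fits) /loop_schur /tableau_sum.
rewrite (@fsum_reindex _ _ _ (fun T => `[< is_tableau N l T >]) _ ffun_of_filling).
- apply: eq_bigr => T _; rewrite /filling_wt.
  rewrite (eq_bigl (mem (box_of @: [set: young lam]%SET))); last first.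
    move=> b /=; apply/idP/idP => [/box_of_surj[b' ->]|/imsetP[b' _ ->]].
      by apply: imset_f; rewrite inE.
    exact: box_of_shape.
  rewrite big_imset /=; last by move=> ? ? _ _; apply: box_of_inj.
  apply: eq_big => [b|b _]; first by rewrite inE.
  rewrite ffunE; apply: x_mod; rewrite /color modz_mod; congr (_ %% _)%Z.
  by have := fsvalP b; rewrite /=; case: (fsval b) => ? ?; rewrite mem_young /=; lia.
- move=> T T' /asboolP tT /asboolP tT' /ffunP TT'; apply/ffunP => b.
  have [bl|bl] := ltnP b.2 (l b.1).
    by have [b' ->] := box_of_surj bl; apply/val_inj; have := TT' b'; rewrite !ffunE.
  apply/val_inj => /=; have := tab_entry tT b; have := tab_entry tT' b.
  by rewrite ltnNge bl => /eqP -> /eqP ->.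
- by move=> T /asboolP; apply: tableau_ssyt.
- move=> T [T0 Trow Tcol] wt0.
  have TN b : (T b <= N)%N.
    rewrite leqNgt; apply: contraNN wt0 => NT.
    by rewrite (bigD1 b) //= x_trunc ?mul0r.
  pose T' : filling := [ffun b => if [pick b' | box_of b' == b] is Some b'
     then inord (T b') else ord0].
  have T'E b : T' (box_of b) = T b :> nat.
    rewrite ffunE; case: pickP => [b' /eqP/box_of_inj ->|/(_ b)]; last by rewrite eqxx.
    by rewrite inordK // ltnS.
  exists T'; last by apply/ffunP => b; rewrite ffunE T'E.
  apply/asboolP; split.
  + move=> b; case: ltnP => [/box_of_surj[b' ->]|bl]; first by rewrite T'E T0 TN.
    rewrite ffunE; case: pickP => //= b' /eqP b'b.
    by have := box_of_shape b'; rewrite b'b ltnNge bl.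
  + move=> r c c' cc' c'l; have /box_of_surj[b eb] : ((r, c).2 < l (r, c).1)%N.
      exact: leq_ltn_trans c'l.
    have /box_of_surj[b' eb'] : ((r, c').2 < l (r, c').1)%N by [].
    rewrite eb eb' !T'E; have [r1 c1] := box_of_val eb.
    have [r2 c2] := box_of_val eb'.
    by apply: Trow; rewrite ?r1 ?r2 // c1 c2.
  + move=> r r' c rr' cl; have /box_of_surj[b eb] : ((r, c).2 < l (r, c).1)%N.
      exact: leq_trans cl (shape_antitone (nth_antitone lam_part) (ltnW rr')).
    have /box_of_surj[b' eb'] : ((r', c).2 < l (r', c).1)%N by [].
    rewrite eb eb' !T'E; have [r1 c1] := box_of_val eb.
    have [r2 c2] := box_of_val eb'.
    by apply: Tcol; rewrite ?c1 ?c2 // r1 r2.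
Qed.
End LoopSchur.

(** * Border strips *)

(** Border strips in terms of row lengths: between its top row t and its bottom
    row b, each row of the strip ends right below the first box of the row above. *)
Record strip_rows (l g : nat -> nat) (t b : nat) : Prop := StripRows {
  strip_above : forall r, (r < t)%N -> g r = l r;
  strip_below : forall r, (b < r)%N -> g r = l r;
  strip_inside : forall r, (t <= r < b)%N -> g r.+1 = (l r).+1;
  strip_ends : (t <= b)%N;
  strip_top : (l t < g t)%N }.

Lemma mem_skew lam sig r c : ((r.+1, c) \in skew_shape sig lam) =
  (nth 0%N lam r < c <= nth 0%N sig r)%N.
Proof. by rewrite in_fsetD !mem_young /=; lia. Qed.

Lemma mem_skew0 lam sig c : ((0%N, c) \in skew_shape sig lam) = false.
Proof. by rewrite in_fsetD !mem_young /=; lia. Qed.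

Lemma young_subP lam sig :
  reflect (forall r, nth 0%N lam r <= nth 0%N sig r)%N
          (young lam `<=` young sig)%fset.
Proof.
apply: (iffP (@fsubsetP _ _ _)) => [sub r|sub [[|r] c]]; rewrite ?mem_young //=.
  have [->//|lr] := posnP (nth 0%N lam r).
  have := sub (r.+1, nth 0%N lam r); rewrite !mem_young /= lr leqnn.
  by move=> /(_ isT).
by move=> /andP[-> /leq_trans]; apply.
Qed.

Lemma card_young lam M : (size lam <= M)%N ->
  #|` young lam| = (\sum_(r < M) nth 0%N lam r)%N.
Proof.
move=> lamM; rewrite /young card_fseq undup_id; last first.
  apply: allpairs_uniq_dep => [|r _|]; rewrite ?iota_uniq //.
  by move=> [r c] [r' c'] _ _ /= [-> ->].
rewrite size_allpairs_dep sumnE big_map (iotaDl 1 0) big_map.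
under eq_bigr do rewrite size_iota.
rewrite -[RHS](big_mkord xpredT (nth 0%N lam)) (big_cat_nat (leq0n _) lamM) /=.
rewrite [X in (_ + X)%N]big_nat [X in (_ + X)%N]big1 ?addn0 ?/index_iota ?subn0 //.
by move=> r /andP[? _]; rewrite nth_default.
Qed.

Section Strip.
Variables (lam sig : seq nat).
Hypothesis lam_part : is_partition lam.
Local Notation l := (nth 0%N lam).
Local Notation g := (nth 0%N sig).
Local Notation D := (skew_shape sig lam).

Let ldec i : (l i.+1 <= l i)%N. Proof. exact: nth_antitone. Qed.

(** Two consecutive rows of the strip share a column since it is connected, and
    only one since it contains no square. *)
Lemma border_strip_rows m : is_partition sig -> (0 < m)%N ->
    adds_border_strip m lam sig ->
  exists t b, strip_rows l g t b.
Proof.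
move=> sig_part m0 [/young_subP lg conn cardD nosq].
have gdec := nth_antitone sig_part.
have [r0 r0P] : exists r, (l r < g r)%N.
  have /fset0Pn[[[|r] c]] : D != fset0 by rewrite -cardfs_gt0 cardD.
    by rewrite mem_skew0.
  by rewrite mem_skew => rc; exists r; lia.
have rbound r : (l r < g r)%N -> (r <= size sig)%N.
  by apply: contraTT; rewrite -ltnNge => sr; rewrite [g r]nth_default // ltnW.
have exr : exists r, (l r < g r)%N by exists r0.
case: (ex_minnP exr) => t tP tmin; case: (ex_maxnP exr rbound) => b bP bmax.
(* Otherwise no edge leaves the rows up to r, which contain a box of row t but
   none of row b. *)
have cross r : (t <= r < b)%N -> (l r < g r.+1)%N.
  case/andP=> tr rb.
  have tD : (t.+1, g t) \in D by rewrite mem_skew tP leqnn.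
  have bD : (b.+1, g b) \in D by rewrite mem_skew bP leqnn.
  pose a := [pred u : D | (val u).1 <= r.+1]%N.
  apply: contraT; rewrite -leqNgt => gl.
  have step (u v : D) : adjacent (val u) (val v) -> u \in a -> v \in a.
    case: u v => [[[|ur] uc] uD] [[[|vr] vc] vD]; rewrite !inE /adjacent /=; try lia.
    move: (uD) (vD); rewrite !mem_skew => /andP[ul ug] /andP[vl vg] uv ur_r.
    have [|urr] := eqVneq ur r; last by lia.
    move=> eur; rewrite eur in ul ug; apply: contraT => vr_r.
    have evr : vr = r.+1 by lia.
    by rewrite evr in vl vg; lia.
  have clo : closed (fun u v : D => adjacent (val u) (val v)) a.
    move=> u v uv; apply/idP/idP; apply: step => //.
    by move: uv; rewrite /adjacent; lia.
  have := closed_connect clo (conn [` tD]%fset [` bD]%fset).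
  by rewrite !inE /= ltnS tr ltnS leqNgt rb.
have tb : (t <= b)%N by apply: tmin.
exists t, b; split=> // r => [rt|br|/[dup] trb /cross lgr].
- by apply/eqP; rewrite eqn_leq lg andbT leqNgt; apply: contraL rt => /tmin; lia.
- by apply/eqP; rewrite eqn_leq lg andbT leqNgt; apply: contraL br => /bmax; lia.
apply/eqP; rewrite eqn_leq lgr andbT leqNgt; apply/negP => lgr2.
apply: nosq; exists r.+1, (l r).+1.
by have := ldec r; have := gdec r; split; rewrite mem_skew; lia.
Qed.

Lemma card_skew M : (size lam <= M)%N -> (size sig <= M)%N ->
    (young lam `<=` young sig)%fset ->
  (#|` D| + \sum_(r < M) l r = \sum_(r < M) g r)%N.
Proof.
move=> lamM sigM sub; rewrite -!card_young // /skew_shape cardfsD.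
by rewrite (fsetIidPr sub) subnK // fsubset_leq_card.
Qed.

Section OfRows.
Variables t b : nat.
Hypothesis rows : strip_rows l g t b.

Lemma strip_row_nonempty r : (l r < g r)%N = (t <= r <= b)%N.
Proof.
have [above below inside tb top] := rows.
have [rt|tr] := ltnP r t; first by rewrite above // ltnn.
have [br|rb] := ltnP b r; first by rewrite below // ltnn.
move: tr; rewrite leq_eqVlt => /orP[/eqP <-|]; first by rewrite top.
case: r rb => // r rb tr; rewrite inside; last by lia.
by rewrite ltnS ldec.
Qed.

Lemma strip_sub : (young lam `<=` young sig)%fset.
Proof.
apply/young_subP => r; have [/ltnW //|] := boolP (l r < g r)%N.
rewrite strip_row_nonempty negb_and -!ltnNge.
by case/orP => [/(strip_above rows) ->|/(strip_below rows) ->].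
Qed.

(** From any box, walking left along its row and then down leads to the first box
    of the bottom row. *)
Lemma strip_connected : edge_connected D.
Proof.
have bD : (b.+1, (l b).+1) \in D.
  by rewrite mem_skew ltnSn strip_row_nonempty leqnn (strip_ends rows).
pose e := fun u v : D => adjacent (val u) (val v).
have e_sym : connect_sym e.
  by apply: sym_connect_sym => u v; rewrite /e /adjacent; lia.
suff toend u : connect e u [` bD]%fset.
  by move=> u v; apply: connect_trans (toend u) _; rewrite e_sym.
have [k] := ubnP (b.+1 - (val u).1 + (val u).2)%N.
elim: k u => // k IH [[[|r] c] rcD] /=; first by have := rcD; rewrite mem_skew0.
move=> mk; have := rcD; rewrite mem_skew => /andP[lc cg].
have := strip_row_nonempty r; rewrite (leq_trans lc cg) => /esym/andP[tr rb].
have link (v : nat * nat) (vD : v \in D) : adjacent (r.+1, c) v ->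
    (b.+1 - v.1 + v.2 < k)%N -> connect e [` rcD]%fset [` bD]%fset.
  move=> uv vk; apply: connect_trans (IH [` vD]%fset vk).
  exact: connect1.
have [lc1|] := ltnP (l r).+1 c.
  have vD : (r.+1, c.-1) \in D by rewrite mem_skew; lia.
  by apply: (link _ vD); rewrite /adjacent /=; lia.
move=> cl; have {lc cl} ec : c = (l r).+1 by lia.
move: rb; rewrite leq_eqVlt => /orP[/eqP rb|rb].
  by rewrite (_ : [` rcD]%fset = [` bD]%fset) //; apply/val_inj; rewrite /= rb ec rb.
have vD : (r.+2, c) \in D.
  by rewrite mem_skew (strip_inside rows) ?tr // ec leqnn andbT ltnS.
by apply: (link _ vD); rewrite /adjacent /=; lia.
Qed.

Lemma strip_no_square : ~ has_square D.
Proof.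
case=> [[|r] [c []]]; rewrite ?mem_skew0 // !mem_skew => rc _ _ rc1.
have := strip_row_nonempty r; have := strip_row_nonempty r.+1.
move=> r1 r0; have := strip_inside rows (r := r).
by rewrite (_ : (t <= r < b)%N); [move=> /(_ isT); lia | lia].
Qed.

Lemma strip_height : height D = (b - t)%N.
Proof.
rewrite /height (_ : [fset u.1 | u in D]%fset = [fset r in iota t.+1 (b - t).+1]%fset).
  by rewrite card_fseq undup_id ?iota_uniq // size_iota.
apply/fsetP => r; rewrite [in RHS]in_fset mem_iota.
apply/imfsetP/idP => /= [[[[|r'] c] + ->]|].
- by rewrite mem_skew0.
- by rewrite mem_skew /= => rc; have := strip_row_nonempty r'; lia.
case: r => // r tb; exists (r.+1, g r) => //; rewrite mem_skew leqnn andbT.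
by rewrite strip_row_nonempty; have := strip_ends rows; lia.
Qed.

End OfRows.
End Strip.

(** The rows of the strip are at most as many as its boxes, and the first of them
    is a row of lam or the next one. *)
Lemma border_strip_size m lam sig : is_partition lam -> (0 < m)%N ->
    is_partition sig -> adds_border_strip m lam sig ->
  (size sig <= size lam + m)%N.
Proof.
move=> lam_part m0 sig_part strip; have [_ _ cardD _] := strip.
have [t [b rows]] := border_strip_rows lam_part sig_part m0 strip.
rewrite leqNgt; apply/negP => sigN.
have lastrow : (nth 0%N lam (size sig).-1 < nth 0%N sig (size sig).-1)%N.
  have sig0 : (0 < size sig)%N by apply: leq_ltn_trans sigN.
  rewrite nth_default; last by lia.
  rewrite lt0n; have /andP[_] := sig_part; apply: contra => /eqP <-.
  by apply: mem_nth; rewrite prednK.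
have tlam : (t <= size lam)%N.
  rewrite leqNgt; apply/negP => lamt.
  have := strip_row_nonempty lam_part rows (size lam).
  rewrite [nth _ lam _]nth_default // [(t <= _)%N]leqNgt lamt /=.
  move=> /negbT; rewrite -leqNgt leqn0 => /eqP sig0.
  have := strip_row_nonempty lam_part rows (size sig).-1; rewrite lastrow.
  have := shape_antitone (nth_antitone sig_part) (i := size lam) (j := (size sig).-1).
  by rewrite sig0; move: lastrow; lia.
have := strip_row_nonempty lam_part rows (size sig).-1; rewrite lastrow.
have : (height (skew_shape sig lam) < m)%N.
  have : (#|` [fset u.1 | u in skew_shape sig lam]%fset| <= m)%N.
    by apply: leq_trans (leq_imfset_card _ _ _) _; rewrite -cardD.
  by rewrite /height; lia.
by rewrite (strip_height lam_part rows); lia.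
Qed.

Definition beta (N : nat) (l : nat -> nat) (r : nat) : nat := (l r + (N - r.+1))%N.

(** On the abacus of beta numbers, the bead of row b advances by s to become the
    one of row t, and the other beads keep their place and order. The comparison of
    the other beads skips b on one side and t on the other. *)
Definition beads_move (N s : nat) (lam sig : seq nat) (b t : 'I_N.+1) : Prop :=
  beta N.+1 (nth 0%N sig) t = (beta N.+1 (nth 0%N lam) b + s)%N /\
  forall k : 'I_N, beta N.+1 (nth 0%N sig) (lift t k) =
                   beta N.+1 (nth 0%N lam) (lift b k).

Lemma beta_decr N (l' : nat -> nat) i j : (forall i, l' i.+1 <= l' i)%N ->
  (i < j)%N -> (j < N.+1)%N -> (beta N.+1 l' j < beta N.+1 l' i)%N.
Proof.
move=> ldec ij jN; have := shape_antitone ldec (ltnW ij).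
by rewrite /beta; lia.
Qed.

Lemma sum_beta N (l' : nat -> nat) (t : 'I_N.+1) :
  (\sum_(r < N.+1) l' r + \sum_(r < N.+1) (N.+1 - r.+1) =
   beta N.+1 l' t + \sum_(k < N) beta N.+1 l' (lift t k))%N.
Proof. by rewrite -big_split /= (bigD1_ord t). Qed.

(** A row of given length has a beta number smaller by one when it lies one row
    further down, which compensates the extra box of [strip_inside]. *)
Lemma strip_rows_beads N (l g : nat -> nat) (t b : 'I_N.+1) :
    strip_rows l g t b -> forall k : 'I_N,
  beta N.+1 g (lift t k) = beta N.+1 l (lift b k).
Proof.
case=> above below inside tb top k; rewrite /beta /= /bump.
have kN := ltn_ord k.
case: (leqP t k) => tk; case: (leqP b k) => bk; rewrite ?add1n ?add0n.
- by rewrite below.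
- by rewrite inside ?tk //; lia.
- lia.
- by rewrite above.
Qed.

Section Beads.
Variables (N s : nat) (lam : seq nat).
Hypothesis lam_part : is_partition lam.
Local Notation l := (nth 0%N lam).

Lemma beta_part_inj (i j : 'I_N.+1) : beta N.+1 l i = beta N.+1 l j -> i = j.
Proof.
move=> eij; apply/val_inj => /=; have ldec := nth_antitone lam_part.
have := ltn_ord i; have := ltn_ord j => jN iN.
have := @beta_decr N l i j ldec; have := @beta_decr N l j i ldec; lia.
Qed.

Lemma border_strip_beads sig : (0 < s)%N -> is_partition sig ->
    (size lam + s <= N.+1)%N -> adds_border_strip s lam sig ->
  exists b t : 'I_N.+1, [/\ beads_move s lam sig b t, (t <= b)%N
    & height (skew_shape sig lam) = (b - t)%N].
Proof.
move=> s0 sig_part lam_s strip.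
have lam_size : (size lam <= N.+1)%N by apply: leq_trans lam_s; rewrite leq_addr.
have [sub _ cardD _] := strip.
have [t [b rows]] := border_strip_rows lam_part sig_part s0 strip.
have sigN : (size sig <= N.+1)%N.
  exact: leq_trans (border_strip_size lam_part s0 sig_part strip) lam_s.
have bN : (b < N.+1)%N.
  rewrite (leq_trans _ sigN) // ltnNge; apply/negP => sb.
  have := strip_row_nonempty lam_part rows b.
  by rewrite [nth _ sig _]nth_default // (strip_ends rows) leqnn.
have tN : (t < N.+1)%N := leq_ltn_trans (strip_ends rows) bN.
exists (Ordinal bN), (Ordinal tN); split; first split.
- have lifts := @strip_rows_beads _ l (nth 0%N sig) (Ordinal tN) (Ordinal bN) rows.
  have := card_skew lam_size sigN sub; rewrite cardD.
  have := sum_beta (nth 0%N sig) (Ordinal tN).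
  have := sum_beta l (Ordinal bN).
  by rewrite (eq_bigr _ (fun k _ => lifts k)) /=; lia.
- exact: strip_rows_beads.
- exact: strip_ends rows.
- exact: strip_height.
Qed.

(** The row t is where the moved bead has to be inserted for the beta numbers to
    decrease again. *)
Lemma beads_border_strip (b : 'I_N.+1) : (size lam <= N.+1)%N -> (0 < s)%N ->
    (forall r : 'I_N.+1, beta N.+1 l r <> (beta N.+1 l b + s)%N) ->
  exists sig (t : 'I_N.+1), [/\ is_partition sig, adds_border_strip s lam sig,
    beads_move s lam sig b t, (t <= b)%N &
    (size sig <= N.+1)%N /\ height (skew_shape sig lam) = (b - t)%N].
Proof.
move=> lam_size s0 free; have ldec := nth_antitone lam_part.
have exb : exists r, (beta N.+1 l r < beta N.+1 l b + s)%N.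
  by exists b; rewrite -[X in (X < _)%N]addn0 ltn_add2l.
case: (ex_minnP exb) => t tlt tmin.
have tb : (t <= b)%N by apply: tmin; rewrite -[X in (X < _)%N]addn0 ltn_add2l.
have bN := ltn_ord b; have tN : (t < N.+1)%N by apply: leq_ltn_trans bN.
have above r : (r < t)%N -> (beta N.+1 l b + s < beta N.+1 l r)%N.
  move=> rt; have := free (Ordinal (ltn_trans rt tN)) => /= nr.
  have := tmin r; lia.
pose g r := if (r < t)%N then l r else if r == t then (l b + s + t - b)%N
   else if (r <= b)%N then (l r.-1).+1 else l r.
have g_above r : (r < t)%N -> g r = l r by rewrite /g => ->.
have g_top : g t = (l b + s + t - b)%N by rewrite /g ltnn eqxx.
have g_inside r : (t <= r < b)%N -> g r.+1 = (l r).+1.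
  by move=> /andP[tr rb]; rewrite /g ltnNge leqW //= gtn_eqF // rb.
have g_below r : (b < r)%N -> g r = l r.
  move=> br; have tr := leq_ltn_trans tb br.
  by rewrite /g ltnNge ltnW //= gtn_eqF // leqNgt br.
have gdec i : (g i.+1 <= g i)%N.
  have [it|ti] := ltnP i.+1 t; first by rewrite !g_above ?ldec // ltnW.
  move: ti; rewrite leq_eqVlt => /orP[/eqP ti|ti].
    rewrite -ti g_top g_above ?ti //; have := above i; rewrite ti ltnSn => /(_ isT).
    by rewrite /beta; lia.
  have [bi|ib] := ltnP b i; first by rewrite !g_below ?ldec // ltnW.
  have g_next : (g i.+1 <= (l i).+1)%N.
    have [ib'|bi] := ltnP i b; first by rewrite g_inside ?ib' ?andbT.
    by rewrite g_below // leqW // ldec.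
  apply: leq_trans g_next _; move: ti; rewrite ltnS leq_eqVlt => /orP[/eqP ti|ti].
    by rewrite -ti g_top; move: tlt; rewrite /beta; lia.
  by case: i ti ib => // i ti ib; rewrite g_inside ?ltnS // -ltnS ti ib.
have gN : g N.+1 = 0%N.
  by rewrite g_below ?nth_default.
have [sig [sig_part sigN sigE]] := partition_of_fun gdec gN.
have rows : strip_rows l (nth 0%N sig) t b.
  split=> // [r rt|r br|r trb|]; rewrite sigE.
  - exact: g_above.
  - exact: g_below.
  - exact: g_inside.
  - by rewrite g_top; move: tlt; rewrite /beta; lia.
have sub := strip_sub lam_part rows.
have bt : beta N.+1 (nth 0%N sig) t = (beta N.+1 l b + s)%N.
  by rewrite /beta sigE g_top; move: tlt; rewrite /beta; lia.
have lifts := @strip_rows_beads _ l (nth 0%N sig) (Ordinal tN) b rows.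
exists sig, (Ordinal tN); split=> //.
- split=> //; last exact: (strip_no_square lam_part rows).
    exact: (strip_connected lam_part rows).
  have := card_skew lam_size sigN sub.
  have := sum_beta (nth 0%N sig) (Ordinal tN).
  have := sum_beta l b.
  by rewrite (eq_bigr _ (fun k _ => lifts k)) /= bt; lia.
by split=> //; apply: (strip_height lam_part rows).
Qed.

End Beads.

(** The moved bead is the only one of lam whose place is empty in sig. *)
Lemma beads_move_inj N s lam sig (b b' t t' : 'I_N.+1) :
    is_partition lam -> (0 < s)%N ->
  beads_move s lam sig b t -> beads_move s lam sig b' t' -> b = b'.
Proof.
move=> lam_part s0 [top lifts] [top' lifts'].
have [k eb|//] := unliftP b' b.
have := lifts' k; rewrite -eb; have [j|] := unliftP t (lift t' k) => ->.
  rewrite lifts => /(beta_part_inj lam_part)/eqP.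
  by rewrite eq_sym (negbTE (neq_lift _ _)).
by rewrite top; lia.
Qed.

(** The target row is the number of the other beads that lie beyond the target, and
    these beads belong to lam. *)
Lemma beads_move_le N s lam sig sig' (b t t' : 'I_N.+1) :
    is_partition sig -> is_partition sig' ->
    beads_move s lam sig b t -> beads_move s lam sig' b t' -> (t' <= t)%N.
Proof.
move=> sp sp' [top lifts] [top' lifts']; rewrite leqNgt; apply/negP => tt'.
have tN : (t < N)%N by have := ltn_ord t'; lia.
pose k := Ordinal tN.
have := lifts k; have := lifts' k.
have := @beta_decr N (nth 0%N sig) t (lift t k) (nth_antitone sp).
have := @beta_decr N (nth 0%N sig') (lift t' k) t' (nth_antitone sp').
rewrite !(ltn_ord (lift _ _)) !ltn_ord /= /bump leqnn [(t' <= t)%N]leqNgt tt' /=.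
by rewrite add0n add1n tt' ltnSn => /(_ isT isT) + /(_ isT isT); lia.
Qed.

Lemma beads_move_uniq N s lam sig sig' (b t t' : 'I_N.+1) :
    is_partition sig -> is_partition sig' ->
    (size sig <= N.+1)%N -> (size sig' <= N.+1)%N ->
    beads_move s lam sig b t -> beads_move s lam sig' b t' -> sig = sig'.
Proof.
move=> sp sp' sN sN' mv mv'; have et : t = t'.
  apply/val_inj/eqP; rewrite /= eqn_leq.
  by rewrite (beads_move_le sp' sp mv' mv) (beads_move_le sp sp' mv mv').
case: mv mv' => top lifts [top' lifts']; rewrite -et in top' lifts'.
apply: partition_ext => // r; have [rN|Nr] := ltnP r N.+1; last first.
  by rewrite !nth_default // (leq_trans _ Nr).
have : beta N.+1 (nth 0%N sig) (Ordinal rN) = beta N.+1 (nth 0%N sig') (Ordinal rN).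
  have [k|] := unliftP t (Ordinal rN) => ->; first by rewrite lifts lifts'.
  by rewrite top top'.
by rewrite /beta /=; lia.
Qed.

(** * The Murnaghan-Nakayama rule *)

(** Sorting the rows after the move is a cycle of length [b - t + 1]; as a
    permutation it is the lift of the identity that sends t to b. *)
Lemma flagged_det_beads_move (A : comNzRingType) (x : int -> nat -> A)
    N s lam sig (b t : 'I_N.+1) : beads_move s lam sig b t ->
  flagged_det x N.+1 (beta N.+1 (nth 0%N sig)) = (-1) ^+ (t + b) *
  flagged_det x N.+1 (fun r => if r == b :> nat then beta N.+1 (nth 0%N lam) r + s
                               else beta N.+1 (nth 0%N lam) r)%N.
Proof.
move=> [top lifts]; rewrite /flagged_det.
set M := (X in _ = _ * \det X).
rewrite -(signr_odd A (t + b)) oddD.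
have -> : (odd t (+) odd b)%B = (lift_perm t b 1)%g :> bool.
  by rewrite odd_lift_perm odd_perm1 addbF.
rewrite -det_perm -det_mulmx -row_permE; congr (\det _).
apply/matrixP => i j; rewrite !mxE; have [k ->|->] := unliftP t i.
  rewrite lift_perm_lift perm1 lifts ifN //.
  by rewrite val_eqE eq_sym neq_lift.
by rewrite lift_perm_id eqxx top.
Qed.

Lemma flagged_det_collision (A : comNzRingType) (x : int -> nat -> A)
    N s (B : nat -> nat) (b r : 'I_N) : (0 < s)%N -> B r = (B b + s)%N ->
  flagged_det x N (fun r => if r == b :> nat then B r + s else B r)%N = 0.
Proof.
move=> s0 eB; have rb : r != b by apply/eqP => rb; move: eB; rewrite rb; lia.
apply: (determinant_alternate rb) => j; rewrite !mxE eqxx ifN //.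
by rewrite eB.
Qed.

(** A bead that lands on another one gives two equal rows. The moves to an empty
    place are exactly the additions of border strips, and the sign of sorting is the
    one of the height. *)
Lemma sum_flagged_det_strips (A : comNzRingType) (x : int -> nat -> A)
    N s lam : is_partition lam -> (0 < s)%N -> (size lam + s <= N.+1)%N ->
  \sum_(b < N.+1) flagged_det x N.+1
     (fun r => if r == b :> nat then beta N.+1 (nth 0%N lam) r + s
               else beta N.+1 (nth 0%N lam) r)%N =
  \sum_(sigma \in [set sigma : seq nat | is_partition sigma /\
                     adds_border_strip s lam sigma]%classic)
    (-1) ^+ height (skew_shape sigma lam) *
    flagged_det x N.+1 (beta N.+1 (nth 0%N sigma)).
Proof.
move=> lam_part s0 lam_s; pose B := beta N.+1 (nth 0%N lam).
have lamN : (size lam <= N.+1)%N by apply: leq_trans lam_s; rewrite leq_addr.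
pose free (b : 'I_N.+1) := [forall r : 'I_N.+1, B r != B b + s]%N.
have /choice[sig sigP] (b : 'I_N.+1) : exists sig, free b -> exists t,
    [/\ is_partition sig, adds_border_strip s lam sig,
    beads_move s lam sig b t, (t <= b)%N &
    (size sig <= N.+1)%N /\ height (skew_shape sig lam) = (b - t)%N].
  have [/forallP fb|_] := boolP (free b); last by exists [::].
  have [|sig ?] := beads_border_strip lam_part (b := b) lamN s0; last by exists sig.
  by move=> r; apply/eqP; apply: fb.
rewrite (@fsum_reindex _ _ _ free _ sig).
- rewrite (bigID free) /= [X in _ + X]big1 ?addr0; last first.
    move=> b; rewrite negb_forall => /existsP[r]; rewrite negbK => /eqP eB.
    exact: flagged_det_collision eB.
  apply: eq_bigr => b /sigP[t [_ _ mv tb [_ ->]]].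
  rewrite (flagged_det_beads_move x mv) mulrA -exprD addnA subnK //.
  by rewrite addnn -signr_odd odd_double mul1r.
- move=> b b' /sigP[t [_ _ mv _ _]] /sigP[t' [_ _ mv' _ _]] e.
  by rewrite -e in mv'; apply: beads_move_inj mv mv'.
- by move=> b /sigP[t [? ? _ _ _]].
(* Any border strip comes from a bead, whose target is free. *)
move=> tau [tau_part tau_strip] _.
have [b [t [mv _ _]]] := border_strip_beads lam_part s0 tau_part lam_s tau_strip.
have fb : free b.
  apply/forallP => r; apply/eqP => eB.
  have [j|] := unliftP b r => er; rewrite er in eB; last by lia.
  case: mv; rewrite -/B -eB => top lifts; have := lifts j; rewrite -/B -top.
  by move/(beta_part_inj tau_part)/eqP; rewrite eq_sym (negbTE (neq_lift _ _)).
exists b => //; have [t' [sig_part _ mv' _ [sigN _]]] := sigP b fb.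
apply: beads_move_uniq mv' mv => //.
exact: leq_trans (border_strip_size lam_part s0 tau_part tau_strip) lam_s.
Qed.

Lemma prod_periodic (A : comNzRingType) (n : nat) (f : int -> A) :
    (forall i, f (i + n%:Z) = f i) -> forall (k : nat) (a : int),
  \prod_(0 <= c < k * n) f (c%:Z + a) = (\prod_(i < n) f i%:Z) ^+ k.
Proof.
move=> per.
have shift1 (a : int) : \prod_(0 <= c < n) f (c%:Z + (a + 1)) =
                \prod_(0 <= c < n) f (c%:Z + a).
  case: n per => [|n'] per; first by rewrite !big_geq.
  rewrite big_nat_recr // big_nat_recl //= mulrC; congr (_ * _).
    by rewrite -[RHS]per; congr f; lia.
  by apply: eq_bigr => c _; congr f; lia.
have shift (a : int) : \prod_(0 <= c < n) f (c%:Z + a) = \prod_(i < n) f i%:Z.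
  elim: a => [|a IH|a IH].
  - by rewrite big_mkord; apply: eq_bigr => i _; rewrite addr0.
  - by rewrite -IH -[RHS]shift1; apply: eq_bigr => i _; congr f; lia.
  - by rewrite -IH -shift1; apply: eq_bigr => i _; congr f; lia.
elim=> [|k IH] a; first by rewrite big_geq.
rewrite mulSn (big_cat_nat (leq0n n) (leq_addr _ _)) /= shift exprS; congr (_ * _).
rewrite -{1}[n]add0n big_addn addKn -[RHS](IH a).
apply: eq_bigr => c _; rewrite -[RHS]per; congr f; lia.
Qed.

Section MurnaghanNakayama.
Variables (A : comNzRingType) (x : int -> nat -> A) (n k N : nat).
Hypothesis x_mod : forall i i' j, (i = i' %[mod n%:Z])%Z -> x i j = x i' j.
Hypothesis x_trunc : forall i j, (N < j)%N -> x i j = 0.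

(** The k-th power of the product of the variables of index j + 1 is their product
    over k consecutive periods, wherever these start: the form in which the trace of
    the shift by k n appears. *)
Lemma loop_power_sumE : (0 < n)%N -> (0 < k)%N ->
  loop_power_sum n x k =
  \sum_(j < N) \prod_(0 <= c < k * n) x (c%:Z - j%:Z) j.+1.
Proof.
move=> n0 k0; rewrite /loop_power_sum.
rewrite (@fsum_reindex _ _ _ xpredT _ (fun j : 'I_N => j.+1)) //=.
- apply: eq_bigr => j _; rewrite (@prod_periodic _ n (fun i => x i j.+1)) //.
  by move=> i; apply: x_mod; rewrite modzDr.
- by move=> i j _ _ [] /val_inj.
case=> // j _; have [jN|Nj /eqP[]] := ltnP j N; first by exists (Ordinal jN).
by rewrite (bigD1 (Ordinal n0)) //= x_trunc // mul0r expr0n gtn_eqF.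
Qed.

(** A border strip of length k n adds at most k n rows, so that lam and every sigma
    have at most N rows and their loop Schur functions are determinants of the same
    size N. *)
Lemma loop_murnaghan_nakayama lam : (0 < n)%N -> (0 < k)%N ->
    is_partition lam -> (k * n + size lam <= N)%N ->
  loop_power_sum n x k * loop_schur n x lam =
  \sum_(sigma \in [set sigma : seq nat | is_partition sigma /\
                     adds_border_strip (k * n) lam sigma]%classic)
    (-1) ^+ height (skew_shape sigma lam) * loop_schur n x sigma.
Proof.
move=> n0 k0 lam_part lam_s; set s := (k * n)%N in lam_s *.
have s0 : (0 < s)%N by rewrite muln_gt0 k0.
have lamN : (size lam <= N)%N by apply: leq_trans lam_s; rewrite leq_addl.
have per i j : x (i + s%:Z) j = x i j.
  by apply: x_mod; rewrite /s PoszM addrC modzMDl.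
rewrite loop_power_sumE // (loop_schur_flagged_det x_mod x_trunc lam_part lamN).
rewrite -/s -(flagged_det_power_sum _ _ per) -/(beta N _).
case: N lamN lam_s x_trunc => [|M] lamN lam_s x_tr; first by lia.
rewrite sum_flagged_det_strips //; last by rewrite addnC.
apply: eq_fsbigr => sigma /set_mem[sig_part strip].
congr (_ * _); rewrite (loop_schur_flagged_det x_mod x_tr sig_part) //.
apply: leq_trans (border_strip_size lam_part s0 sig_part strip) _.
by rewrite addnC.
Qed.

End MurnaghanNakayama.

Theorem theorem1 (R : comNzRingType) (n k N : nat) (lambda : seq nat)
    (hn : (1 <= n)%N) (hk : (1 <= k)%N) (hlambda : is_partition lambda)
    (hN : (k * n + size lambda <= N)%N) :
  power_sumN R n N k * xdelta R n N * schurN R n N lambda =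
  \sum_(sigma \in [set sigma : seq nat | is_partition sigma /\
                     adds_border_strip (k * n) lambda sigma]%classic)
    (-1) ^+ height (skew_shape sigma lambda) * xdelta R n N * schurN R n N sigma.
Proof.
rewrite -mulrA mulrCA /power_sumN /schurN.
rewrite (@loop_murnaghan_nakayama _ _ n k N (@xvar_mod R n N) (@xvar_trunc R n N)) //.
rewrite fsbig_distrr; last exact: finite_add_border_strip.
by apply: eq_fsbigr => sigma _; rewrite /= mulrCA mulrA.
Qed.
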